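(* Let $N\ge 1$ be an integer and let $f(s)=\sum_{k\ge 0}p_k s^k$ be the offspring probability generating function of a Bienaymé–Galton–Watson process, with $f(1)=1$, $p_k<1$ for all $k$, and $p_k>0$ for some $k>N$. Let $V_N$ be the number of disjoint complete infinite $N$-ary subtrees rooted at the ancestor of the family tree, and let $\tau_N=P(V_N>0)$. Then for every $j=0,1,2,\ldots$ $$P(V_N=j)=G_N(\tau_N,1-\tau_N;j),$$ and $P(V_N=0)=1-\tau_N$ is the smallest solution in $[0,1]$ of the equation $$x=G_N(1-x,x;0),$$ where $G_N(x,y;j)=\sum_{k=jN}^{jN+N-1}\frac{x^k}{k!}f^{(k)}(y)$.
   Context: The process starts with one ancestor (the root, height 0); each individual independently has $k$ children with probability $p_k$, where $p_k\ge 0$, $\sum_k p_k=1$. The family tree has the individuals as nodes and the parent–child relations as arcs; the height of a node is its generation. A complete infinite $N$-ary tree is a rooted tree in which every node has exactly $N$ children (the family tree of the deterministic branching process with offspring generating function $s^N$). Subtrees considered are those rooted at the ancestor; two such subtrees are disjoint if they have no common node other than the root. $V_N$ is the (maximal) number of pairwise disjoint complete infinite $N$-ary subtrees of the family tree rooted at the ancestor. $f^{(k)}$ denotes the $k$-th derivative ($f^{(0)}=f$), with $f^{(k)}(1)$ understood as the left limit at $1$ (possibly $+\infty$); conventions $0^0=1$ and $0\cdot\infty=0$ are used in $G_N$. *)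

(* Defs.v *)
From mathcomp Require Export all_boot all_order all_algebra.
From mathcomp Require Export all_classical all_reals all_analysis.
Export Order.TTheory GRing.Theory Num.Theory numFieldNormedType.Exports.

Set Implicit Arguments.
Unset Strict Implicit.
Unset Printing Implicit Defensive.

Local Open Scope classical_set_scope.
Local Open Scope ring_scope.

(* Individuals are labelled as in the Ulam-Harris scheme: the root is [::] and
   [rcons u i] is the (i+1)-th child of u; c u is the number of children of u
   (it is irrelevant when u is not born). *)
Inductive family_tree (c : seq nat -> nat) : set (seq nat) :=
| family_root : family_tree c [::]
| family_child u i : family_tree c u -> (i < c u)%N ->
    family_tree c (rcons u i).

Definition nary_subtree (N : nat) (T S : set (seq nat)) : Prop :=
  [/\ S `<=` T,
      S [::],
      (forall u i, S (rcons u i) -> S u) &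
      (forall u, S u -> ([set i | S (rcons u i)] #= `I_N)%card)].

Definition has_disjoint_subtrees (N : nat) (T : set (seq nat)) (j : nat) :
    Prop :=
  exists S : 'I_j -> set (seq nat),
    (forall i, nary_subtree N T (S i)) /\
    (forall i k, i != k -> S i `&` S k = [set [::]]).

(* The default value 0 is never used when N >= 1 and T is a family tree: by
   [num_disjoint_subtreesP] below, the maximum is attained. *)
Definition num_disjoint_subtrees (N : nat) (T : set (seq nat)) : nat :=
  xget 0%N [set j | has_disjoint_subtrees N T j /\
                    forall i, has_disjoint_subtrees N T i -> (i <= j)%N].

Lemma family_tree_child (c : seq nat -> nat) u i :
  family_tree c (rcons u i) -> (i < c u)%N.
Proof.
move E : (rcons u i) => v tv; case: tv E => [|u' i' _ lt_i]; first by case: u.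
by move/rcons_inj => [-> ->].
Qed.

Lemma has_disjoint_subtrees_le (N : nat) (c : seq nat -> nat) j :
  (0 < N)%N -> has_disjoint_subtrees N (family_tree c) j -> (j <= c [::])%N.
Proof.
move=> N0 [S [Snary Sdisj]].
have child k : {i : 'I_(c [::]) | S k [:: val i]}.
  apply/cid; have [ST Sroot _ /(_ _ Sroot) Scard] := Snary k.
  have /set0P[i /= Si] : [set i | S k (rcons [::] i)] != set0.
    apply/eqP => S0; move: Scard; rewrite S0 card_eq_sym card_eq0.
    by move=> /eqP/seteqP[/(_ 0%N N0)].
  by exists (Ordinal (@family_tree_child c [::] i (ST [:: i] Si))).
suff /leq_card : injective (fun k => sval (child k)) by rewrite !card_ord.
move=> k l kl; apply: contrapT => /eqP kl_neq.
have : (S k `&` S l) [:: val (sval (child k))].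
  by split; [exact: (svalP (child k)) | rewrite kl; exact: (svalP (child l))].
by rewrite Sdisj.
Qed.

Lemma num_disjoint_subtreesP (N : nat) (c : seq nat -> nat) :
  let T := family_tree c in
  (0 < N)%N ->
  has_disjoint_subtrees N T (num_disjoint_subtrees N T) /\
  forall i, has_disjoint_subtrees N T i ->
    (i <= num_disjoint_subtrees N T)%N.
Proof.
move=> T N0.
suff ex_max : exists j, has_disjoint_subtrees N T j /\
    forall i, has_disjoint_subtrees N T i -> (i <= j)%N.
  exact: (xgetPex 0%N ex_max).
have ex0 : exists j, `[< has_disjoint_subtrees N T j >].
  by exists 0%N; apply/asboolP; exists (fun=> set0); split; case.
have ub j : `[< has_disjoint_subtrees N T j >] -> (j <= c [::])%N.
  by move/asboolP; exact: has_disjoint_subtrees_le.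
have [m /asboolP mT m_max] := ex_maxnP ex0 ub.
by exists m; split => // i iT; apply: m_max; exact/asboolP.
Qed.

(* Events about X u range over all sets of naturals, the sigma-algebra of nat
   being discrete. *)
Definition is_BGW (d : measure_display) (Omega : measurableType d)
    (R : realType) (P : probability Omega R) (p : nat -> R)
    (X : seq nat -> {RV P >-> nat}) : Prop :=
  (forall u k, P [set w | X u w = k] = (p k)%:E) /\
  (forall (s : seq (seq nat)) (B : seq nat -> set nat), uniq s ->
     P [set w | forall u, u \in s -> B u (X u w)] =
     (\prod_(u <- s) P (X u @^-1` B u))%E).

Definition pgf (R : realType) (p : nat -> R) (s : R) : R :=
  limn (series (fun k => p k * s ^+ k)).

(* k-th derivative at y in [0, 1], with values in the extended reals: at 1 it
   is the left limit, which may be +oo. *)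
Definition pgf_deriv (R : realType) (p : nat -> R) (k : nat) (y : R) : \bar R :=
  if y == 1 then lim ((derive1n k (pgf p) s)%:E @[s --> 1^'-])
  else (derive1n k (pgf p) y)%:E.

(* In the extended reals of the library, 0 * +oo = 0. *)
Definition GN (R : realType) (p : nat -> R) (N : nat) (x y : R) (j : nat) :
    \bar R :=
  (\sum_(j * N <= k < j * N + N) (x ^+ k / k`!%:R)%:E * pgf_deriv p k y)%E.

Definition VN (d : measure_display) (Omega : measurableType d)
    (R : realType) (P : probability Omega R) (N : nat)
    (X : seq nat -> {RV P >-> nat}) (w : Omega) : nat :=
  num_disjoint_subtrees N (family_tree (fun u => X u w)).

(* Main.v *)
(* Call a node full if it is the root of a complete infinite N-ary subtree, and
   let K be the number of full children of the ancestor. Disjoint N-ary subtrees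
   at the ancestor use disjoint sets of N full children, so V_N = K %/ N, and
   the ancestor is full iff N <= K. Given its number m of children, K is
   binomial (m, tau), so P(K >= l) = H_l(tau), where
   H_l(r) = sum_m p_m P(Bin(m, r) >= l), and the differences H_(jN) - H_(jN+N)
   are the power series G_N. By the same recursion tau is the limit of the
   iterates of H_N at 1 (the probabilities that the ancestor is full up to depth
   n); as H_N is nondecreasing, tau is its largest fixed point in [0, 1]. *)
Require Import Defs.
From mathcomp Require Import ring lra.

Set Implicit Arguments.
Unset Strict Implicit.
Unset Printing Implicit Defensive.

Local Open Scope classical_set_scope.
Local Open Scope ring_scope.

(** * Full nodes and disjoint N-ary subtrees of a fixed tree *)

Section FullNodes.
Local Open Scope nat_scope.
Variables (N : nat) (c : seq nat -> nat).

Definition count_children (a : pred (seq nat)) (u : seq nat) : nat :=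
  count (fun i => a (rcons u i)) (iota 0 (c u)).

Fixpoint full_upto (n : nat) (u : seq nat) : bool :=
  if n is n'.+1 then N <= count_children (full_upto n') u else true.

(** Quantifying over finite depths makes fullness a countable intersection of events; [fullP]
    recovers the recursive characterization. Unborn nodes are allowed, so that all nodes are treated
    alike. *)
Definition full (u : seq nat) : bool := `[< forall n, full_upto n u >].

Lemma full_uptoS n u : full_upto n.+1 u -> full_upto n u.
Proof.
elim: n u => [//|n IHn] u /leq_trans; apply.
by apply: sub_count => i; exact: IHn.
Qed.

Lemma full_upto_le m n u : m <= n -> full_upto n u -> full_upto m u.
Proof.
move=> /subnK <-; elim: (n - m) => [//|k IHk].
by rewrite addSn => /full_uptoS.
Qed.

(* Koenig's lemma: u has finitely many children and fullness up to depth n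
   decreases with n, so some finite depth decides which children are full. *)
Lemma fullP u : full u = (N <= count_children full u).
Proof.
apply/idP/idP => [/asboolP fu|Nu]; last first.
  apply/asboolP => -[//|n]; apply: leq_trans Nu _.
  by apply: sub_count => i /asboolP; exact.
suff [n nP] : exists n, {in iota 0 (c u),
    forall i, full_upto n (rcons u i) -> full (rcons u i)}.
  have /leq_trans := fu n.+1; apply.
  by rewrite /count_children -2!size_filter -[X in size X <= _](@eq_in_filter _
    (fun i => full (rcons u i) && full_upto n (rcons u i)))
    => [|i /nP ni]; rewrite ?size_filter; [apply: sub_count => i /andP[]|
    apply/andP/idP => [[]//|/[dup]/ni]].
elim: (iota _ _) => [|i s [n nP]]; first by exists 0.
have [|/existsNP[m mP]] := pselect (forall m, full_upto m (rcons u i)).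
  move=> fi; exists n => k; rewrite inE => /predU1P[-> _|/nP//].
  exact/asboolP.
exists (maxn m n) => k; rewrite inE => /predU1P[->|/nP nk].
  by move/(full_upto_le (leq_maxl _ _))/mP.
by move/(full_upto_le (leq_maxr _ _))/nk.
Qed.

Lemma card_eq_uniq_seq (A : set nat) n : (A #= `I_n)%card <->
  exists s : seq nat, [/\ uniq s, size s = n & A = [set` s]].
Proof.
split=> [|[s [us <- ->]]].
  rewrite card_eq_sym => /card_set_bijP[f [fA finj fsurj]].
  exists (map f (iota 0 n)); split; rewrite ?size_map ?size_iota//.
    rewrite map_inj_in_uniq ?iota_uniq// => x y.
    rewrite !mem_iota /= add0n => xn yn; apply: finj; exact/mem_set.
  apply/seteqP; split=> [x /fsurj[y yn <-]|x /mapP[y + ->]].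
    by apply/mapP; exists y => //; rewrite mem_iota.
  by rewrite mem_iota; exact: fA.
rewrite card_eq_sym; apply/card_set_bijP; exists (nth 0 s); split.
- by move=> i /= i_s; rewrite mem_nth.
- by move=> i k /set_mem /= i_s /set_mem /= k_s /eqP;
    rewrite nth_uniq// => /eqP.
- by move=> x /= /(nthP 0)[i i_s <-]; exists i.
Qed.

(** Induction on the depth: the N successors of [u] in [S] are children of [u], and they are full up
    to the previous depth. *)
Lemma nary_subtree_full (S : set (seq nat)) u :
  nary_subtree N (family_tree c) S -> S u -> full u.
Proof.
move=> [ST _ _ Scard] Su; apply/asboolP => n;
  elim: n u Su => [//|n IHn] u Su /=.
have /card_eq_uniq_seq[s [us <- sE]] := Scard _ Su.
rewrite /count_children -size_filter; apply: uniq_leq_size => // i i_s.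
have Sui : S (rcons u i) by have : [set` s] i by []; rewrite -sE.
by rewrite mem_filter IHn//= mem_iota add0n (family_tree_child (ST _ Sui)).
Qed.

Inductive selected (sel : seq nat -> seq nat) : set (seq nat) :=
| selected_root : selected sel [::]
| selected_child u i : selected sel u -> i \in sel u -> selected sel (rcons u
  i).

Lemma selectedP sel u i :
  selected sel (rcons u i) -> selected sel u /\ i \in sel u.
Proof.
move E : (rcons u i) => v tv; case: tv E => [|u' i' su si]; first by case: u.
by move/rcons_inj => [-> ->].
Qed.

Lemma selected_head sel i u : selected sel (i :: u) -> i \in sel [::].
Proof.
elim/last_ind: u => [|u k IHu]; first by case/(@selectedP sel [::]).
by rewrite -rcons_cons => /selectedP[/IHu].
Qed.

(** The size is required at selected nodes only: in the application [sel] lists full children, and a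
    node that is not full has fewer than N of them. *)
Lemma selected_nary_subtree sel :
  (forall u, uniq (sel u) /\ {in sel u, forall i, i < c u}) ->
  (forall u, selected sel u -> size (sel u) = N) ->
  nary_subtree N (family_tree c) (selected sel).
Proof.
move=> selP size_sel; split.
- move=> u; elim=> [|v i sv Tv i_v]; first exact: family_root.
  by apply: family_child => //; exact: (selP v).2.
- exact: selected_root.
- by move=> u i /selectedP[].
- move=> u su; apply/card_eq_uniq_seq; exists (sel u).
  split; [exact: (selP u).1|exact: size_sel|].
  by apply/seteqP; split=> i /= => [/selectedP[]|]; [|exact: selected_child].
Qed.

Definition full_children u := [seq i <- iota 0 (c u) | full (rcons u i)].

Lemma size_full_children u : size (full_children u) = count_children full u.
Proof. exact: size_filter. Qed.

Lemma mem_full_children u i :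
  (i \in full_children u) = full (rcons u i) && (i < c u).
Proof. by rewrite mem_filter mem_iota. Qed.

(** Disjoint subtrees use disjoint N-sets of full children of the root. Conversely, the full
    children of the root are cut into blocks of N, and each block grows a subtree by following full
    children forever. *)
Lemma has_disjoint_subtreesE j :
  has_disjoint_subtrees N (family_tree c) j <->
  j * N <= count_children full [::].
Proof.
split=> [[S [Snary Sdisj]]|jN].
  have /choice[s sP] i : exists s : seq nat,
      [/\ uniq s, size s = N & [set k | S i [:: k]] = [set` s]].
    by have [_ S0 _ /(_ _ S0) /card_eq_uniq_seq] := Snary i.
  (* [f] enumerates the first generations of all [j] subtrees; it is injective since two subtrees
     share only the root. *)
  pose f (x : 'I_j * 'I_N) := nth 0 (s x.1) x.2.
  have fS x : S x.1 [:: f x].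
    have [_ sizes sE] := sP x.1.
    suff : [set` s x.1] (f x) by rewrite -sE.
    by rewrite /= mem_nth// sizes.
  have finj : injective f.
    move=> [i k] [i' k'] ff.
    have ii' : i = i'.
      apply: contrapT => /eqP/Sdisj/seteqP[+ _] => /(_ [:: f (i, k)]).
      have /= := fS (i, k); have /= := fS (i', k'); rewrite -ff.
      by move=> S1 S2 /(_ (conj S2 S1)).
    move: ff; rewrite -{}ii' /f /= => /eqP.
    have [us sizes _] := sP i.
    by rewrite nth_uniq ?sizes// => /eqP/val_inj ->.
  rewrite -size_full_children -{1}(card_ord j) -(card_ord N) -card_prod cardE.
  rewrite -(size_map f); apply: uniq_leq_size.
    by rewrite map_inj_uniq ?enum_uniq.
  move=> k /mapP[x _ ->]; rewrite mem_full_children.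
  have [ST _ _ _] := Snary x.1.
  rewrite (nary_subtree_full (Snary x.1) (fS x))/=.
  exact: (@family_tree_child c [::] _ (ST _ (fS x))).
pose L := full_children [::].
have uL : uniq L by rewrite filter_uniq// iota_uniq.
(* Tree [g] takes the [g]-th block of N full children at the root, and the first N full children
   elsewhere. *)
pose sel (g : 'I_j) u :=
  if u is [::] then take N (drop (g * N) L) else take N (full_children u).
have sel_full g u i : i \in sel g u -> i \in full_children u.
  by case: u => [/mem_take/mem_drop|? ? /mem_take].
exists (fun g => selected (sel g)); split=> [g|g h gh].
  apply: selected_nary_subtree => [u|u su].
    split; first by case: u => [|? ?];
      rewrite take_uniq ?drop_uniq ?filter_uniq ?iota_uniq.
    by move=> i /sel_full; rewrite mem_full_children => /andP[].
  have : u = [::] \/ full u.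
    case: su => [|v i _ /sel_full]; first by left.
    by rewrite mem_full_children => /andP[fv _]; right.
  case: u su => [_ _|k u _ [//|fu]]; rewrite size_takel//.
    rewrite size_drop size_full_children leq_subRL.
      by rewrite -mulSnr (leq_trans _ jN)// leq_mul2r ltn_ord orbT.
    by rewrite (leq_trans _ jN)// leq_mul2r ltnW ?orbT.
  by rewrite size_full_children -fullP.
(* The position in [L] of a first-generation node determines its tree, so a common node other than
   the root forces equal indices. *)
have block k x : x \in sel k [::] -> index x L %/ N = k.
  move=> /(nthP 0)[m]; rewrite size_take_min leq_min size_drop => /andP[mN ms]
    <-.
  rewrite nth_take// nth_drop index_uniq//; last by rewrite -ltn_subRL.
  by rewrite divnMDl ?(leq_ltn_trans _ mN)// divn_small// addn0.
apply/seteqP; split=> [[//|i u] [/selected_head sg /selected_head sh]|u ->].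
  by move/eqP: gh => []; apply: val_inj;
    rewrite /= -(block _ _ sg) (block _ _ sh).
by split; exact: selected_root.
Qed.

Lemma num_disjoint_subtreesE : 0 < N ->
  num_disjoint_subtrees N (family_tree c) = count_children full [::] %/ N.
Proof.
move=> N0; have [/has_disjoint_subtreesE le_num num_max] :=
  num_disjoint_subtreesP c N0.
apply/eqP; rewrite eqn_leq leq_divRL// le_num /=.
by apply: num_max; apply/has_disjoint_subtreesE; rewrite leq_trunc_div.
Qed.

End FullNodes.

(** * Tails of the binomial distribution *)

Section BinomialTail.
Variable R : realType.
Implicit Types (r : R) (m l : nat).

(* The probability that a binomial (m, r) variable is at least l. *)
Fixpoint binomial_tail r m l : R :=
  match l, m with
  | 0%N, _ => 1
  | _.+1, 0%N => 0
  | l'.+1, m'.+1 =>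
      r * binomial_tail r m' l' + (1 - r) * binomial_tail r m' l'.+1
  end.

Lemma binomial_tail0 r m : binomial_tail r m 0 = 1.
Proof. by case: m. Qed.

Lemma binomial_tail_ge0 r m l : 0 <= r <= 1 -> 0 <= binomial_tail r m l.
Proof.
move=> /andP[r0 r1]; elim: m l => [[]//|m IHm] [//|l] /=.
by rewrite addr_ge0 ?mulr_ge0 ?subr_ge0.
Qed.

(** The point mass at [l]; the induction on [m] is Pascal's rule. *)
Lemma binomial_tailB r m l :
  binomial_tail r m l - binomial_tail r m l.+1 =
  'C(m, l)%:R * r ^+ l * (1 - r) ^+ (m - l).
Proof.
elim: m l => [|m IHm] [|l] /=; rewrite ?bin0 ?bin0n ?expr0 ?subn0 ?mul1r ?mul0r
  ?subrr//=.
- by rewrite subr0.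
- have := IHm 0%N; rewrite bin0 !binomial_tail0 expr0 !mul1r subn0 exprS => <-.
  ring.
- have -> (a b d : R) : r * a + (1 - r) * b - (r * b + (1 - r) * d) =
    r * (a - b) + (1 - r) * (b - d) by ring.
  rewrite !IHm binS natrD subSS exprS.
  have [lm|ml] := ltnP l m; last by rewrite (bin_small (n := m) (m := l.+1))//;
    ring.
  have -> : (m - l = (m - l.+1).+1)%N by rewrite subnSK.
  by rewrite exprS; ring.
Qed.

Lemma binomial_tail_sum r m l n :
  binomial_tail r m l - binomial_tail r m (l + n) =
  \sum_(l <= k < l + n) 'C(m, k)%:R * r ^+ k * (1 - r) ^+ (m - k).
Proof.
under eq_bigr do rewrite -binomial_tailB.
elim: n => [|n IHn]; first by rewrite addn0 big_geq ?subrr.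
rewrite addnS big_nat_recr ?leq_addr//= -IHn; ring.
Qed.

Lemma binomial_tail_nonincr r m l : 0 <= r <= 1 ->
  binomial_tail r m l.+1 <= binomial_tail r m l.
Proof.
move=> /andP[r0 r1]; rewrite -subr_ge0 binomial_tailB.
by rewrite !mulr_ge0 ?exprn_ge0 ?subr_ge0.
Qed.

Lemma binomial_tail_le1 r m l : 0 <= r <= 1 -> binomial_tail r m l <= 1.
Proof.
move=> r01; elim: l => [|l IHl]; first by rewrite binomial_tail0.
exact: le_trans (binomial_tail_nonincr _ _ r01) IHl.
Qed.

Lemma binomial_tail_homo r s m l : 0 <= r -> r <= s -> s <= 1 ->
  binomial_tail r m l <= binomial_tail s m l.
Proof.
move=> r0 rs s1; have r01 : 0 <= r <= 1 by rewrite r0 (le_trans rs).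
have s0 := le_trans r0 rs.
elim: m l => [[]//|m IHm] [//|l] /=.
(* The intermediate term gives success probability [s] to the first trial only; raising it helps
   because the tail decreases in [l]. *)
apply: (@le_trans _ _
    (s * binomial_tail r m l + (1 - s) * binomial_tail r m l.+1)).
  rewrite -subr_ge0.
  have -> (a b : R) : s * a + (1 - s) * b - (r * a + (1 - r) * b) =
    (s - r) * (a - b) by ring.
  by rewrite mulr_ge0// subr_ge0// binomial_tail_nonincr.
by apply: lerD; rewrite ler_wpM2l// subr_ge0.
Qed.

End BinomialTail.

(** * Derivatives of the generating function and the series form of [GN] *)

Section PgfDerivatives.
Variables (R : realType).
Implicit Types (f : nat -> R) (y : R).

(** In the factorization of the right side by [b - a], each of the [n.+1] summands is at least
    [a ^+ n]. This bounds differentiated terms by terms at a larger radius. *)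
Lemma natrS_expr_le (a b : R) n : 0 <= a -> a <= b ->
  n.+1%:R * a ^+ n * (b - a) <= b ^+ n.+1 - a ^+ n.+1.
Proof.
move=> a0 ab; rewrite subrXX mulrC; apply: ler_wpM2l; first by rewrite subr_ge0.
rewrite mulr_natl -[X in _ *+ X]card_ord -sumr_const; apply: ler_sum => i _.
rewrite -[X in a ^+ X <= _](@subnK i n); last by rewrite -ltnS.
by rewrite exprD ler_wpM2r ?exprn_ge0// lerXn2r ?nnegrE// (le_trans a0).
Qed.

Lemma is_cvg_pseries_diffs f :
  (forall x : R, `|x| < 1 -> cvgn (pseries f x)) ->
  forall x : R, `|x| < 1 -> cvgn (pseries (pseries_diffs f) x).
Proof.
(* The comparison takes place at a radius [b] strictly between [|x|] and 1; a further point [e]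
   between [b] and 1 gives absolute convergence at [b]. *)
move=> f_cvg x x1; pose b := (1 + `|x|) / 2; have x0 := normr_ge0 x.
have xb : `|x| < b by rewrite /b; lra.
have b1 : b < 1 by rewrite /b; lra.
have b0 : 0 <= b by rewrite (le_trans x0)// ltW.
pose e := (1 + b) / 2.
have fb : cvgn (pseries (fun i => `|f i|) b).
  apply: (@is_cvg_pseries_inside_norm _ _ e); first by apply: f_cvg;
    rewrite ger0_norm /e; lra.
  by rewrite !ger0_norm /e; lra.
have fbS : cvgn (series (fun i => `|f i.+1| * b ^+ i.+1)).
  rewrite (_ : series _ = fun n => pseries (fun i => `|f i|) b n.+1 - `|f 0%N|).
    apply: is_cvgB; last exact: is_cvg_cst.
    by have /cvg_ex[l fl] := fb; apply/cvg_ex; exists l; rewrite cvg_shiftS.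
  apply/funext => n; rewrite /pseries /series/= big_nat_recl//= expr0 mulr1.
  by rewrite addrAC subrr add0r.
apply: normed_cvg; apply: (@series_le_cvg _ _ (fun i => (b - `|x|)^-1 * (`|f
  i.+1| * b ^+ i.+1))).
- by move=> n; exact: normr_ge0.
- by move=> n; rewrite !mulr_ge0 ?invr_ge0 ?exprn_ge0// subr_ge0 ltW.
- move=> n; rewrite /pseries_diffs/= !normrM normrX ger0_norm//.
  rewrite [leRHS]mulrC ler_pdivlMr ?subr_gt0//.
  rewrite [leLHS](_ : _ = `|f n.+1| * (n.+1%:R * `|x| ^+ n * (b - `|x|)));
    last by ring.
  have := natrS_expr_le n x0 (ltW xb).
  have : 0 <= `|x| ^+ n.+1 by rewrite exprn_ge0.
  by move=> ? ?; rewrite ler_wpM2l//; lra.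
- exact: (is_cvg_seriesZ (k := (b - `|x|)^-1) fbS).
Qed.

Lemma is_cvg_iter_pseries_diffs f k :
  (forall x : R, `|x| < 1 -> cvgn (pseries f x)) ->
  forall x : R, `|x| < 1 -> cvgn (pseries (iter k (@pseries_diffs R) f) x).
Proof. by move=> f_cvg; elim: k => //= k IHk; exact: is_cvg_pseries_diffs. Qed.

Lemma iter_pseries_diffsE f k m :
  iter k (@pseries_diffs R) f m = ((m + k) ^_ k)%:R * f (m + k)%N.
Proof.
elim: k m => [|k IHk] m /=; first by rewrite addn0 ffactn0 mul1r.
by rewrite /pseries_diffs IHk mulrA -natrM addSnnS ffactnSr addnS -addSn addnK
  mulnC.
Qed.

Lemma derive1n_pgf f k y :
  (forall x : R, `|x| < 1 -> cvgn (pseries f x)) -> `|y| < 1 ->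
  derive1n k (pgf f) y = limn (pseries (iter k (@pseries_diffs R) f) y).
Proof.
move=> f_cvg; elim: k y => [//|k IHk] y y1.
rewrite derive1nS derive1E; pose e := (1 + `|y|) / 2; have y0 := normr_ge0 y.
have e1 : `|e| < 1 by rewrite ger0_norm /e; lra.
have ye : `|y| < `|e| by rewrite [ltRHS]ger0_norm /e; lra.
have f_cvg_e j := is_cvg_iter_pseries_diffs (k := j) f_cvg e1.
have := pseries_snd_diffs (f_cvg_e k) (f_cvg_e k.+1) (f_cvg_e k.+2) ye.
move=> fy; have [_ <-] := fy.
apply: near_eq_derive.
(* The induction hypothesis holds on the open unit disc only, hence near [y], which suffices for
   equality of derivatives at [y]. *)
have : \near y, `|y| < 1 :> R.
  apply: (@cvgr_norm_lt _ _ _ (nbhs y) _ id y _ 1 y1); exact: cvg_id.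
by apply: filterS => x; exact: IHk.
Qed.

Section Probability_pgf.
Variable p : nat -> R.
Hypotheses (p_ge0 : forall k, 0 <= p k) (p_sum1 : series p @ \oo --> (1 : R)).

Lemma is_cvg_pseries_pgf (x : R) : `|x| < 1 -> cvgn (pseries p x).
Proof.
move=> x1; apply: (@is_cvg_pseries_inside _ _ 1); last by rewrite normr1.
apply/cvg_ex; exists (1 : R); rewrite /pseries.
by under eq_fun do rewrite expr1n mulr1.
Qed.

Lemma pgf_derivE k y : 0 <= y < 1 -> pgf_deriv p k y =
  (\sum_(m <oo) (((m + k) ^_ k)%:R * p (m + k)%N * y ^+ m)%:E)%E.
Proof.
move=> /andP[y0 y1]; have ny1 : `|y| < 1 by rewrite ger0_norm.
rewrite /pgf_deriv lt_eqF// derive1n_pgf//; last exact: is_cvg_pseries_pgf.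
rewrite -EFin_lim; last exact: is_cvg_iter_pseries_diffs is_cvg_pseries_pgf _
  ny1.
apply/congr_lim/funext => n; rewrite /pseries /series /= sumEFin.
by congr EFin; apply: eq_bigr => m _; rewrite iter_pseries_diffsE.
Qed.

(** Taylor coefficients become binomial ones, since [(m + k) ^_ k] divided by [k!] is
    ['C(m + k, k)]; nonnegativity allows exchanging the sums. *)
Lemma GN_lt1 N (t y : R) j : 0 <= t -> 0 <= y < 1 -> GN p N t y j =
  (\sum_(m <oo) (p m * \sum_(j * N <= k < j * N + N)
     'C(m, k)%:R * t ^+ k * y ^+ (m - k))%:E)%E.
Proof.
move=> t0 y01; have /andP[y0 _] := y01.
pose g k m : \bar R := (p m * ('C(m, k)%:R * t ^+ k * y ^+ (m - k)))%:E.
have g_ge0 k m : (0 <= g k m)%E by rewrite lee_fin !mulr_ge0 ?exprn_ge0.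
under eq_eseriesr do rewrite mulr_sumr -sumEFin.
rewrite (nneseries_sum_nat _ _ (f := g))//.
apply: eq_bigr => k _; rewrite pgf_derivE// -nneseriesZl; last first.
  by move=> m _; rewrite lee_fin !mulr_ge0 ?exprn_ge0.
(* The terms with [m < k] vanish with ['C(m, k)], so the index can be shifted by [k] to match the
   derivative. *)
rewrite (nneseries_split 0 k)// add0n big1_seq ?add0e => [|m]; last first.
  by rewrite mem_index_iota => /andP[_ /andP[_ mk]];
    rewrite /g bin_small// !mul0r mulr0.
rewrite -nneseries_addn//; apply: eq_eseriesr => m _.
rewrite /g addnK -EFinM; congr EFin.
rewrite -bin_ffact natrM.
have : k`!%:R != 0 :> R by rewrite pnatr_eq0 -lt0n fact_gt0.
by move=> ?; field.
Qed.

(** Abel's theorem for nonnegative coefficients: near 1 the function lies between a partial sum, a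
    continuous polynomial with value close to 1, and 1 itself. *)
Lemma pgf_cvg_at_left1 : pgf p s @[s --> 1^'-] --> (1 : R).
Proof.
have S_le1 n : series p n <= 1.
  rewrite -(cvg_lim _ p_sum1)//; apply: nondecreasing_cvgn_le;
    last by apply/cvg_ex; exists 1.
  by apply: nondecreasing_series => *; exact: p_ge0.
have pgf_le (s : R) : 0 <= s -> s < 1 ->
    (forall n, pseries p s n <= pgf p s) /\ pgf p s <= 1.
  move=> s0 s1; have cs : cvgn (pseries p s).
    by apply: is_cvg_pseries_pgf; rewrite ger0_norm.
  split=> [n|].
    apply: nondecreasing_cvgn_le => //.
    by apply: nondecreasing_series => *; rewrite mulr_ge0 ?exprn_ge0.
  apply: limr_le => //; apply: nearW => n; apply: le_trans (S_le1 n).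
  by apply: ler_sum => k _; rewrite ler_piMr ?exprn_ile1 //= ?ltW.
apply/cvgrPdist_lt => e e0.
have /cvgrPdist_lt/(_ (e / 2)) := p_sum1.
rewrite divr_gt0// => /(_ isT)[n _ /(_ n (leqnn n))/= Sn].
have : (\sum_(0 <= k < n) p k * s ^+ k) @[s --> 1^'-] --> series p n.
  apply: cvg_at_left_filter.
  have -> : series p n = \sum_(0 <= k < n) p k * 1 ^+ k.
    by apply: eq_bigr => k _; rewrite expr1n mulr1.
  apply: cvg_big => [|k _]; first exact: add_continuous.
  by apply: cvgM; [exact: cvg_cst|exact: exprn_continuous].
move=> /cvgrPdist_lt/(_ (e / 2)); rewrite divr_gt0// => /(_ isT) Hs.
near=> s.
have s0 : 0 <= s by near: s; apply: nbhs_left_ge.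
have s1 : s < 1 by near: s; exact: nbhs_left_lt.
have [/(_ n) pn ?] := pgf_le _ s0 s1.
have : `|series p n - \sum_(0 <= k < n) p k * s ^+ k| < e / 2 by near: s.
rewrite /pseries /series/= in pn Sn *; rewrite !ltr_distlC => /andP[? ?].
move: Sn; rewrite ltr_distlC => /andP[? ?].
by apply/andP; split; lra.
Unshelve. all: by end_near. Qed.

(** The case [tau = 0]: derivatives at 1 may be infinite, but the factor 0 kills every term with
    [k > 0], and the term [k = 0] is the left limit of [pgf p]. *)
Lemma GN01 N j : (0 < N)%N -> GN p N 0 1 j = ((j == 0)%N%:R)%:E.
Proof.
move=> N0; rewrite /GN.
have zero k : (0 < k)%N -> ((0 ^+ k / k`!%:R)%:E * pgf_deriv p k 1 = 0)%E.
  by move=> k0; rewrite expr0n gtn_eqF//= mul0r mul0e.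
case: j => [|j].
  rewrite mul0n add0n big_ltn// big1_seq => [|k].
    rewrite adde0 expr0 fact0 divr1 mul1e /pgf_deriv eqxx /=.
    apply: cvg_lim => //; apply: cvg_EFin => //.
      exact: nearW.
    exact: pgf_cvg_at_left1.
  by rewrite mem_index_iota => /andP[_ /andP[k0 _]]; exact: zero.
rewrite big1_seq// => k; rewrite mem_index_iota => /andP[_ /andP[k0 _]].
by apply: zero; rewrite (leq_trans _ k0)// muln_gt0.
Qed.

Lemma sum_pgf : (\sum_(m <oo) (p m)%:E)%E = 1%:E.
Proof.
have cp : cvgn (series p) by apply/cvg_ex; exists 1.
rewrite -(cvg_lim _ p_sum1)// -EFin_lim//.
by apply/congr_lim/funext => n; rewrite /series /= sumEFin.
Qed.

End Probability_pgf.
End PgfDerivatives.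

(** * The functions [H_l] and their relation to [GN] *)

Section OffspringTail.
Variables (R : realType) (p : nat -> R).
Hypotheses (p_ge0 : forall k, 0 <= p k) (p_sum1 : series p @ \oo --> (1 : R)).
Implicit Types (r : R) (l : nat).

(** This is [H_l(r)]; for [r] in [0, 1] the sum is at most 1, so [fine] loses nothing. *)
Definition offspring_tail l r : R :=
  fine (\sum_(m <oo) (p m * binomial_tail r m l)%:E)%E.

Lemma offspring_tailE l r : 0 <= r <= 1 ->
  (\sum_(m <oo) (p m * binomial_tail r m l)%:E)%E = (offspring_tail l r)%:E.
Proof.
move=> r01; rewrite fineK// ge0_fin_numE; last first.
  by apply: nneseries_ge0 => m _ _; rewrite lee_fin mulr_ge0 ?binomial_tail_ge0.
apply: (@le_lt_trans _ _ 1%:E); last exact: ltry.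
rewrite -(sum_pgf p_sum1); apply: lee_nneseries => m _.
  by rewrite lee_fin mulr_ge0 ?binomial_tail_ge0.
by rewrite lee_fin ler_piMr ?binomial_tail_le1.
Qed.

Lemma offspring_tail_ge0 l r : 0 <= r <= 1 -> 0 <= offspring_tail l r.
Proof.
move=> r01; rewrite -lee_fin -offspring_tailE//; apply: nneseries_ge0 => m _ _.
by rewrite lee_fin mulr_ge0 ?binomial_tail_ge0.
Qed.

Lemma offspring_tail_le1 l r : 0 <= r <= 1 -> offspring_tail l r <= 1.
Proof.
move=> r01; rewrite -lee_fin -offspring_tailE// -(sum_pgf p_sum1).
by apply: lee_nneseries => m _; rewrite lee_fin ?mulr_ge0 ?ler_piMr
  ?binomial_tail_ge0 ?binomial_tail_le1.
Qed.

Lemma offspring_tail_homo l r s : 0 <= r -> r <= s -> s <= 1 ->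
  offspring_tail l r <= offspring_tail l s.
Proof.
move=> r0 rs s1; rewrite -lee_fin -!offspring_tailE ?r0 ?(le_trans rs)//;
  last first.
  by rewrite (le_trans r0 rs).
apply: lee_nneseries => m _; last by rewrite lee_fin ler_wpM2l
  ?binomial_tail_homo.
by rewrite lee_fin mulr_ge0 ?binomial_tail_ge0 ?r0 ?(le_trans rs).
Qed.

Lemma offspring_tail_iter l n : 0 <= iter n (offspring_tail l) 1 <= 1.
Proof.
elim: n => [|n IHn] /=; first by rewrite ler01 lexx.
by rewrite offspring_tail_ge0 ?offspring_tail_le1.
Qed.

(** Termwise, [GN] collects the binomial masses between the two tails. Positive [r] keeps [1 - r]
    away from 1, where the power series formula could fail. *)
Lemma offspring_tail_GN N r j : 0 < r <= 1 ->
  (offspring_tail (j * N) r)%:E =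
  (GN p N r (1 - r) j + (offspring_tail (j * N + N) r)%:E)%E.
Proof.
move=> /andP[r0 r1]; have r01 : 0 <= r <= 1 by rewrite ltW.
have y01 : 0 <= 1 - r < 1 by apply/andP; split; lra.
rewrite (GN_lt1 p_ge0 p_sum1 _ _ (ltW r0) y01).
rewrite -!offspring_tailE// -nneseriesD => [|m _ _|m _ _].
- apply: eq_eseriesr => m _; rewrite -EFinD -mulrDr -binomial_tail_sum.
  by rewrite subrK.
- rewrite lee_fin mulr_ge0// -binomial_tail_sum subr_ge0.
  move: (j * N)%N => q; elim: N => [|n IHn]; first by rewrite addn0.
  by rewrite addnS (le_trans (binomial_tail_nonincr _ _ r01) IHn).
- by rewrite lee_fin mulr_ge0 ?binomial_tail_ge0.
Qed.

Lemma offspring_tail0 r : offspring_tail 0 r = 1.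
Proof.
rewrite /offspring_tail; under eq_eseriesr do rewrite binomial_tail0 mulr1.
by rewrite (sum_pgf p_sum1).
Qed.

Lemma offspring_tail_fixpoint N x : 0 <= x < 1 ->
  x%:E = GN p N (1 - x) x 0 -> offspring_tail N (1 - x) = 1 - x.
Proof.
move=> /andP[x0 x1] xG; have y01 : 0 < 1 - x <= 1 by apply/andP; split; lra.
have := offspring_tail_GN N 0 y01;
  rewrite subKr -xG mul0n add0n offspring_tail0.
by rewrite -EFinD => -[h]; lra.
Qed.

End OffspringTail.

(** * Independence along subtrees and the law of the number of marked children *)

Section BienaymeGaltonWatson.
Variables (d : measure_display) (Omega : measurableType d) (R : realType).
Variables (P : probability Omega R) (p : nat -> R) (X :
  seq nat -> {RV P >-> nat}).
Hypothesis X_BGW : is_BGW p X.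
Hypotheses (p_ge0 : forall k, 0 <= p k) (p_sum1 : series p @ \oo --> (1 : R)).

Definition box (s : seq (seq nat)) (B : seq nat -> set nat) : set Omega :=
  [set w | forall u, u \in s -> B u (X u w)].

(* Independence of E from (X u) for u in D, tested on finite boxes only. *)
Definition independent_of (D : set (seq nat)) (E : set Omega) : Prop :=
  measurable E /\ forall s B, uniq s -> (forall u, u \in s -> D u) ->
    P (E `&` box s B) = (P E * \prod_(u <- s) P (X u @^-1` B u))%E.

Definition below (u : seq nat) : set (seq nat) := [set v | prefix u v].

(** What remains unexplored under [u] once its first [k] child subtrees have been examined. *)
Definition below_children (u : seq nat) (k : nat) : set (seq nat) :=
  [set v | exists2 i, (k <= i)%N & below (rcons u i) v].

Lemma below_rcons u i : below (rcons u i) `<=` below u.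
Proof. by move=> v; apply: prefix_trans; exact: prefix_rcons. Qed.

Lemma below_disjoint u i k v :
  below (rcons u i) v -> below (rcons u k) v -> i = k.
Proof.
move=> /prefixP[s ->] /prefixP[t]; rewrite !cat_rcons => /eqP.
by rewrite eqseq_cat// eqxx /= => /eqP[].
Qed.

Lemma measurable_box s B : measurable (box s B).
Proof.
elim: s => [|u s IHs].
  by rewrite (_ : box _ _ = setT)//; apply/seteqP; split.
rewrite (_ : box _ _ = X u @^-1` B u `&` box s B).
  by apply: measurableI => //; exact: measurable_funPTI.
apply/seteqP; split=> [w ws|w [wu ws] v]; last first.
  by rewrite inE => /predU1P[->//|]; exact: ws.
by split=> [|v vs]; apply: ws; rewrite inE ?eqxx// vs orbT.
Qed.

Lemma independent_of_setT D : independent_of D setT.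
Proof.
split=> // s B us _; rewrite setTI probability_setT mul1e.
exact: X_BGW.2.
Qed.

Lemma independent_of_box D D' E s B : independent_of D E -> uniq s ->
  (forall u, u \in s -> D u) -> D' `<=` D -> (forall u, D' u -> u \notin s) ->
  independent_of D' (E `&` box s B).
Proof.
move=> [mE indE] us sD D'D D's.
split=> [|t C ut tD']; first by apply: measurableI => //; exact: measurable_box.
(* [s] and [t] are disjoint, so the two boxes merge into one over [s ++ t]. *)
pose BC u := if u \in s then B u else C u.
have -> : E `&` box s B `&` box t C = E `&` box (s ++ t) BC.
  rewrite -setIA; congr (_ `&` _); apply/seteqP; split=> w.
    move=> [ws wt] u; rewrite mem_cat /BC; case: ifPn => [us' _|_ /= ut'].
      exact: ws.
    exact: wt.
  move=> wst; split=> u u_in; have := wst u; rewrite mem_cat u_in ?orbT /BC.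
    by rewrite u_in; exact.
  by rewrite (negPf (D's _ (tD' _ u_in))); exact.
rewrite indE//; last 2 first.
- rewrite cat_uniq us ut andbT /=; apply/hasPn => u /tD'; exact: D's.
- by move=> u; rewrite mem_cat => /orP[/sD//|/tD'/D'D].
rewrite indE// -muleA big_cat /=; congr (_ * (_ * _))%E;
  apply: eq_big_seq => u u_in.
  by rewrite /BC u_in.
by rewrite /BC (negPf (D's _ (tD' _ u_in))).
Qed.

(* Independence of the events [a u] for u in disjoint subtrees is obtained
   without sigma-algebras: intersecting E with one of them preserves
   [independent_of] on the remaining subtrees. *)
Section EventFamily.
Variables (a : seq nat -> Omega -> bool) (r : R).
Hypothesis measurable_a : forall u, measurable [set w | a u w].
(** The instances are fullness up to a fixed depth and fullness itself. Quantifying over [E]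
    expresses that [a u] depends only on the subtree below [u]. *)
Hypothesis prob_a : forall u E, independent_of (below u) E ->
  P (E `&` [set w | a u w]) = (P E * r%:E)%E.

Lemma measurable_a_eq u b : measurable [set w | a u w = b].
Proof.
case: b; first exact: measurable_a.
rewrite (_ : mkset _ = ~` [set w | a u w]); first exact: measurableC.
by apply/seteqP; split=> w /= => [->|/negP/negPf].
Qed.

Lemma prob_a_eq u b E : independent_of (below u) E ->
  P (E `&` [set w | a u w = b]) = (P E * (if b then r else 1 - r)%:E)%E.
Proof.
move=> indE; have aE := prob_a indE; case: b => //.
have PE : P E \is a fin_num by apply: fin_num_measure; exact: indE.1.
have : P E = (P (E `\` [set w | a u w]) + P (E `&` [set w | a u w]))%E.
  exact: measureDI indE.1 (measurable_a u).
rewrite aE.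
rewrite (_ : E `\` _ = E `&` [set w | a u w = false]); last first.
  apply/seteqP; split=> w /= [Ew]; first by move=> /negP/negPf.
  by move=> ->.
have : P (E `&` [set w | a u w = false]) \is a fin_num.
  by apply: fin_num_measure; apply: measurableI indE.1 (measurable_a_eq _ _).
rewrite -(fineK PE) => /fineK <-; rewrite -!EFinM -EFinD => -[PE_split].
by congr EFin; lra.
Qed.

(** The box on [D'] avoids the subtree below [u], so it can be absorbed into the conditioning event
    before [prob_a_eq] is applied. *)
Lemma independent_of_a D D' E u b : independent_of D E ->
  below u `<=` D -> D' `<=` D -> (forall v, D' v -> ~ below u v) ->
  independent_of D' (E `&` [set w | a u w = b]).
Proof.
move=> indE uD D'D D'u; split.
  by apply: measurableI indE.1 (measurable_a_eq _ _).
move=> s B us sD'.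
have indEs : independent_of (below u) (E `&` box s B).
  apply: independent_of_box indE us _ uD _ => [v /sD'/D'D//|v uv].
  by apply/negP => /sD'/D'u.
have indEu : independent_of (below u) E.
  split=> [|t C ut tu]; first exact: indE.1.
  by rewrite indE.2// => v /tu/uD.
rewrite setIAC prob_a_eq// prob_a_eq// indE.2//; last by move=> v /sD'/D'D.
by rewrite -!muleA; congr (_ * _)%E; rewrite muleC.
Qed.

Lemma measurable_count_ge u l s :
  measurable [set w | (l <= count (fun i => a (rcons u i) w) s)%N].
Proof.
elim: s l => [|i s IHs] l /=.
  by case: l => [|l]; [rewrite (_ : mkset _ = setT)|rewrite (_ :
    mkset _ = set0)];
    rewrite //; apply/seteqP; split.
rewrite (_ : mkset _ = ([set w | a (rcons u i) w] `&`
    [set w | (l.-1 <= count (fun i => a (rcons u i) w) s)%N]) `|`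
    [set w | (l <= count (fun i => a (rcons u i) w) s)%N]).
  by apply: measurableU => //; exact: measurableI.
apply/seteqP; split=> w /=.
  by case: (a _ w) => /= h; [left; split=> //; rewrite -subn1 leq_subLR|right].
move=> [[-> /=]|/leq_trans]; last by apply; rewrite leq_addl.
by rewrite -subn1 leq_subLR.
Qed.

(** Conditioning on child [k] reproduces the recursion of [binomial_tail]; either outcome leaves the
    event independent of the later children's subtrees. *)
Lemma prob_count_ge u k m l E : independent_of (below_children u k) E ->
  P (E `&` [set w | (l <= count (fun i => a (rcons u i) w) (iota k m))%N]) =
  (P E * (binomial_tail r m l)%:E)%E.
Proof.
elim: m k l E => [|m IHm] k [|l] E indE /=.
- by rewrite mule1; congr (P _); apply/seteqP; split=> w //= [].
- by rewrite mule0 (_ : _ `&` _ = set0) ?measure0//; apply/seteqP;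
    split=> w //= [].
- by rewrite mule1; congr (P _); apply/seteqP; split=> w //= [].
have below_k : below (rcons u k) `<=` below_children u k by move=> v kv;
  exists k.
have belowSk : below_children u k.+1 `<=` below_children u k.
  by move=> v [i /ltnW ki iv]; exists i.
have disj v : below_children u k.+1 v -> ~ below (rcons u k) v.
  by move=> [i ki /below_disjoint] ik /ik ikE; rewrite ikE ltnn in ki.
have indEk b := independent_of_a b indE below_k belowSk disj.
have indE' : independent_of (below (rcons u k)) E.
  split=> [|t C ut tu]; first exact: indE.1.
  by rewrite indE.2// => v /tu/below_k.
pose c w := count (fun i => a (rcons u i) w) (iota k.+1 m).
rewrite (_ : E `&` _ =
  (E `&` [set w | a (rcons u k) w = true] `&` [set w | (l <= c w)%N]) `|`
  (E `&` [set w | a (rcons u k) w = false] `&` [set w | (l.+1 <= c w)%N]));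
    last first.
  apply/seteqP; split=> w /=; rewrite /c; last by move=> [[[Ew ->]]|[[Ew ->]]].
  by case: (a _ w) => -[Ew lc]; [left|right].
transitivity (P (E `&` [set w | a (rcons u k) w = true] `&` [set w |
  (l <= c w)%N]) +
    P (E `&` [set w | a (rcons u k) w = false] `&` [set w |
      (l.+1 <= c w)%N]))%E.
  apply: measureU.
  - exact: measurableI (indEk true).1 (measurable_count_ge _ _ _).
  - exact: measurableI (indEk false).1 (measurable_count_ge _ _ _).
  - by apply/seteqP; split=> w //= [[[_ ->]]] _ [[]].
rewrite !IHm// !prob_a_eq// -!muleA -muleDr//.
exact: fin_num_measure indE.1.
Qed.

Lemma measurable_count_children u l : measurable
  [set w | (l <= count_children (X^~ w) (a^~ w) u)%N].
Proof.
rewrite (_ : mkset _ = \bigcup_k (X u @^-1` [set k] `&`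
    [set w | (l <= count (fun i => a (rcons u i) w) (iota 0 k))%N])).
  apply: bigcup_measurable => k _; apply: measurableI;
    first exact: measurable_funPTI.
  exact: measurable_count_ge.
apply/seteqP; split=> w /=; first by exists (X u w).
by move=> [k _ [/= <-]].
Qed.

Lemma prob_count_children u l E : 0 <= r <= 1 -> independent_of (below u) E ->
  P (E `&` [set w | (l <= count_children (X^~ w) (a^~ w) u)%N]) =
  (P E * (offspring_tail p l r)%:E)%E.
Proof.
move=> r01 indE.
(* The event is partitioned by the value [k] of [X u], which fixes the number of trials. *)
pose F k := E `&` box [:: u] (fun=> [set k]) `&`
  [set w | (l <= count (fun i => a (rcons u i) w) (iota 0 k))%N].
have ind k : independent_of (below_children u 0) (E `&` box [::
  u] (fun=> [set k])).
  apply: independent_of_box indE _ _ _ _ => //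
    [v|v [i _]|v [i _ /prefixP[t ->]]].
  - by rewrite inE => /eqP ->; exact: prefix_refl.
  - exact: below_rcons.
  - rewrite inE; apply/eqP => /(congr1 size)/eqP.
    by rewrite size_cat size_rcons addSn eqn_leq ltnNge leq_addr.
have mF k : measurable (F k).
  by apply: measurableI (ind k).1 (measurable_count_ge _ _ _).
rewrite (_ : _ `&` _ = \bigcup_k F k); last first.
  apply/seteqP; split=> w /=.
    by move=> [Ew lw]; exists (X u w) => //; split=> //; split=> // v;
      rewrite inE => /eqP ->.
  by move=> [k _ [[Ew /(_ u)]]] /=; rewrite inE eqxx => /(_ isT) <-.
transitivity (\sum_(k <oo) P (F k))%E.
  apply: measure_semi_bigcup => //; last exact: bigcup_measurable.
  move=> i j _ _ [w [[[_ /(_ u) Xi] _] [[_ /(_ u) Xj] _]]].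
  by move: Xi Xj; rewrite inE eqxx => /(_ isT) /= -> /(_ isT).
have PE : P E \is a fin_num by apply: fin_num_measure; exact: indE.1.
rewrite -offspring_tailE// -(fineK PE) -nneseriesZl; last first.
  by move=> m _; rewrite lee_fin mulr_ge0 ?binomial_tail_ge0.
apply: eq_eseriesr => m _; rewrite /F prob_count_ge//.
rewrite indE.2//; last by move=> v; rewrite inE => /eqP ->; exact: prefix_refl.
rewrite big_seq1 fineK// -muleA EFinM.
by have [-> _] := X_BGW.
Qed.

End EventFamily.

End BienaymeGaltonWatson.

(** * The probability that the root is full *)

Section FullTree.
Variables (d : measure_display) (Omega : measurableType d) (R : realType).
Variables (P : probability Omega R) (p : nat -> R) (X :
  seq nat -> {RV P >-> nat}).
Hypothesis X_BGW : is_BGW p X.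
Hypotheses (p_ge0 : forall k, 0 <= p k) (p_sum1 : series p @ \oo --> (1 : R)).
Variable N : nat.

Local Notation Xfull_upto n u w := (full_upto N (X^~ w) n u).
Local Notation Xfull u w := (full N (X^~ w) u).
Local Notation r n := (iter n (offspring_tail p N) 1).

Definition prob_full : R := fine (P [set w | Xfull [::] w]).

Lemma measurable_full_upto n u : measurable [set w | Xfull_upto n u w].
Proof.
elim: n u => [|n IHn] u.
  by rewrite (_ : mkset _ = setT)//; apply/seteqP; split.
exact: (measurable_count_children X (a := fun u w => Xfull_upto n u w)).
Qed.

Lemma bigcap_full_upto u :
  [set w | Xfull u w] = \bigcap_n [set w | Xfull_upto n u w].
Proof.
apply/seteqP; split=> w /=; first by move=> /asboolP fw n _; exact: fw.
by move=> fw; apply/asboolP => n; exact: fw.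
Qed.

Lemma measurable_full u : measurable [set w | Xfull u w].
Proof.
by rewrite bigcap_full_upto; apply: bigcap_measurable => // n _;
  exact: measurable_full_upto.
Qed.

(** The induction hypothesis is the hypothesis [prob_a] for depth [n], so one more generation
    applies [offspring_tail p N] once more. *)
Lemma prob_full_uptoI n u E : independent_of X (below u) E ->
  P (E `&` [set w | Xfull_upto n u w]) = (P E * (r n)%:E)%E.
Proof.
elim: n u E => [|n IHn] u E indE.
  by rewrite mule1; congr (P _); apply/seteqP; split=> w //= [].
apply: (prob_count_children X_BGW p_ge0 p_sum1 (a := fun u w => Xfull_upto n u
  w)) => //.
- exact: measurable_full_upto.
- exact: offspring_tail_iter.
Qed.

Lemma cvg_prob_full_upto u E : measurable E ->
  P (E `&` [set w | Xfull_upto n u w]) @[n --> \oo] --> P (E `&` [set w |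
    Xfull u w]).
Proof.
move=> mE; rewrite bigcap_full_upto -bigcapIr//.
apply: nonincreasing_cvg_mu.
- by rewrite -ge0_fin_numE// fin_num_measure//;
    apply: measurableI mE (measurable_full_upto _ _).
- by move=> n; apply: measurableI mE (measurable_full_upto _ _).
- by apply: bigcap_measurable => // n _;
    apply: measurableI mE (measurable_full_upto _ _).
- by apply/nonincreasing_seqP => n; apply/subsetPset => w [Ew /full_uptoS].
Qed.

Lemma prob_fullE : P [set w | Xfull [::] w] = prob_full%:E.
Proof. by rewrite fineK// fin_num_measure//; exact: measurable_full. Qed.

Lemma cvg_prob_full : r n @[n --> \oo] --> prob_full.
Proof.
rewrite (_ : (fun n => r n) =
    fine \o (fun n => P (setT `&` [set w | Xfull_upto n [::] w]))); last first.
  apply/funext => n /=; rewrite prob_full_uptoI ?probability_setT ?mul1e//.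
  exact: (independent_of_setT X_BGW).
have := cvg_prob_full_upto (u := [::]) (@measurableT _ Omega).
rewrite (_ : P (setT `&` [set w | Xfull [::] w]) = prob_full%:E).
  exact: fine_cvg.
by rewrite setTI prob_fullE.
Qed.

Lemma prob_full01 : 0 <= prob_full <= 1.
Proof.
rewrite -!lee_fin -prob_fullE measure_ge0 probability_le1//.
exact: measurable_full.
Qed.

(** Limit of [prob_full_uptoI] in the depth; it makes fullness an admissible event family. *)
Lemma prob_fullI u E : independent_of X (below u) E ->
  P (E `&` [set w | Xfull u w]) = (P E * prob_full%:E)%E.
Proof.
move=> indE; have PE : P E \is a fin_num by apply: fin_num_measure;
  exact: indE.1.
have cr : (P E * (r n)%:E)%E @[n --> \oo] --> (P E * prob_full%:E)%E.
  by apply: cvgeZl => //; apply: cvg_EFin; [exact: nearW|exact: cvg_prob_full].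
rewrite -(cvg_lim _ cr)// -(cvg_lim _ (cvg_prob_full_upto (u := u) indE.1))//.
by apply/congr_lim/funext => n; rewrite prob_full_uptoI.
Qed.

Lemma prob_full_children l :
  P [set w | (l <= count_children (X^~ w) (fun u => Xfull u w) [::])%N] =
  (offspring_tail p l prob_full)%:E.
Proof.
have indT := independent_of_setT X_BGW (below [::]).
have := prob_count_children X_BGW p_ge0 p_sum1 measurable_full prob_fullI l
  prob_full01 indT.
by rewrite setTI probability_setT mul1e.
Qed.

(** A fixed point is at most 1, the first iterate; monotonicity keeps it below all iterates, hence
    below their limit. *)
Lemma prob_full_max x : 0 <= x <= 1 -> offspring_tail p N x = x -> x <=
  prob_full.
Proof.
move=> /andP[x0 x1] xE; rewrite -(cvg_lim _ cvg_prob_full)//.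
apply: limr_ge; first by apply/cvg_ex; exists prob_full; exact: cvg_prob_full.
apply: nearW; elim=> [//|n IHn] /=; rewrite -xE.
apply: offspring_tail_homo => //.
by have /andP[] := offspring_tail_iter p_ge0 p_sum1 N n.
Qed.

End FullTree.

(** * The law of [VN] and the smallest solution *)

Theorem theorem1 (R : realType) (d : measure_display)
    (Omega : measurableType d) (P : probability Omega R)
    (N : nat) (p : nat -> R) (X : seq nat -> {RV P >-> nat})
    (N_ge1 : (1 <= N)%N)
    (p_ge0 : forall k, 0 <= p k)
    (p_sum1 : series p @ \oo --> (1 : R))
    (p_lt1 : forall k, p k < 1)
    (p_gtN : exists k, (N < k)%N /\ 0 < p k)
    (X_BGW : is_BGW p X) :
  let tau : R := fine (P [set w | (0 < VN N X w)%N]) in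
  (forall j : nat, P [set w | VN N X w = j] = GN p N tau (1 - tau) j) /\
  [/\ P [set w | VN N X w = 0%N] = (1 - tau)%:E,
      0 <= 1 - tau <= 1,
      (1 - tau)%:E = GN p N (1 - (1 - tau)) (1 - tau) 0 &
      forall x : R, 0 <= x <= 1 -> x%:E = GN p N (1 - x) x 0 -> 1 - tau <= x].
Proof.
move=> tau.
have VNE w : VN N X w = (count_children (X^~ w) (full N (X^~ w)) [::] %/ N)%N.
  exact: num_disjoint_subtreesE.
(* [C l] is the event that K is at least [l]. *)
pose C l := [set w | (l <= count_children (X^~ w) (full N (X^~ w)) [::])%N].
have mC l : measurable (C l).
  exact: (measurable_count_children X (measurable_full X N)).
have tauE : tau = prob_full X N.
  rewrite /tau /prob_full; congr (fine (P _)); apply/seteqP; split=> w /=;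
    by rewrite VNE divn_gt0// fullP.
have tau01 : 0 <= tau <= 1 by rewrite tauE prob_full01.
have PC l : P (C l) = (offspring_tail p l tau)%:E by rewrite tauE;
  exact: prob_full_children.
have PCN : P (C N) = tau%:E.
  by rewrite tauE -prob_fullE; congr (P _); apply/seteqP; split=> w /=;
    rewrite /C/= fullP.
have VN_C j : [set w | VN N X w = j] = C (j * N)%N `\` C (j * N + N)%N.
  apply/seteqP; split=> w /=; rewrite /C/= VNE -mulSnr -!leq_divRL//.
    by move=> ->; rewrite ltnn.
  by move=> [jK /negP]; rewrite -leqNgt => Kj; apply/eqP; rewrite eqn_leq Kj.
have C_split j : P (C (j * N)%N) =
    (P [set w | VN N X w = j] + P (C (j * N + N)%N))%E.
  have CI : C (j * N)%N `&` C (j * N + N)%N = C (j * N + N)%N.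
    by apply: setIidr => w; apply: leq_trans; rewrite leq_addr.
  by have := measureDI P (mC (j * N)%N) (mC (j * N + N)%N); rewrite CI VN_C.
have P0 : P [set w | VN N X w = 0%N] = (1 - tau)%:E.
  have := C_split 0%N; rewrite mul0n add0n PCN PC offspring_tail0// => PCE.
  by rewrite EFinB {}PCE addeK.
have PV j : P [set w | VN N X w = j] = GN p N tau (1 - tau) j.
  have /andP[tau_ge0 tau_le1] := tau01.
  (* If [tau = 0], the events with positive [j] lie in the null event [C N], and [GN01] gives the
     right side. *)
  have [tau0|tau_neq0] := eqVneq tau 0.
    rewrite tau0 subr0 GN01//; case: j => [|j]; first by rewrite P0 tau0 subr0.
    apply/eqP; rewrite /= mulr0n eq_le measure_ge0 andbT -tau0 -PCN.
    apply: le_measure; rewrite ?inE//; first by rewrite VN_C;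
      exact: measurableD.
    by rewrite VN_C => w [+ _]; apply: leq_trans; rewrite leq_pmull.
  have tau_gt0 : 0 < tau <= 1 by rewrite lt_def tau_neq0 tau_ge0.
  have := C_split j; rewrite !PC offspring_tail_GN//
    => /(congr1 (fun y => y - (offspring_tail p (j * N + N) tau)%:E)%E).
  by rewrite !addeK.
split=> //; split=> //.
- by have /andP[? ?] := tau01; apply/andP; split; lra.
- by rewrite subKr -PV P0.
- move=> x /andP[x0 x1] xG; have /andP[? ?] := tau01.
  (* The solution [x = 1] satisfies the bound trivially; any other makes [1 - x] a fixed point of
     [H_N]. *)
  have [->|x_neq1] := eqVneq x 1; first lra.
  have x_lt1 : 0 <= x < 1 by rewrite x0 lt_neqAle x_neq1.
  have : 1 - x <= tau.
    rewrite tauE; apply: (prob_full_max X_BGW p_ge0 p_sum1);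
      first by apply/andP; split; lra.
    exact: offspring_tail_fixpoint.
  lra.
Qed.
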